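(* For any integer $q \ge 1$, any interval $\mathcal{J} = \{L+1, \ldots, L+N\} \subseteq [1,q-1]$ of $N$ consecutive integers, and any sequence of complex weights $\mathcal{W} = \{\omega_\chi\}_{\chi \in \Omega_q^*}$, the sum $$ \mathcal{T}_q(\mathcal{W};\mathcal{J}) = \sum_{\chi \in \Omega_q^*} \sum_{n \in \mathcal{J}} \omega_\chi\, \mathcal{G}_q(\chi,n) $$ satisfies $$ \mathcal{T}_q(\mathcal{W};\mathcal{J}) \ll \left( \|\mathcal{W}\|_1 \|\mathcal{W}\|_2\right)^{1/2} \left(q + N^{1/2} q^{3/4}\right) q^{o(1)}. $$
   Context: $\mathbb{Z}_q^*$ is the group of units of the residue ring $\mathbb{Z}_q$ modulo $q$, and $\Omega_q^*$ is the set of primitive Dirichlet characters modulo $q$. For a Dirichlet character $\chi$ modulo $q$ and an integer $n$, the Gauss sum is $$ \mathcal{G}_q(\chi,n) = \sum_{x \in \mathbb{Z}_q^*} \chi(x)\, \mathbf{e}_q(nx), \qquad \mathbf{e}_q(z) = \exp(2\pi i z/q). $$ For $\sigma>0$, $\|\mathcal{W}\|_\sigma = \left(\sum_{\chi \in \Omega_q^*} |\omega_\chi|^\sigma\right)^{1/\sigma}$. $A \ll B$ means $|A| \le cB$ with a constant $c>0$, here absolute. The bound with $q^{o(1)}$ means: for every $\delta>0$ there is a constant $C(\delta)$, depending only on $\delta$, such that the bound holds with $q^{o(1)}$ replaced by $C(\delta) q^{\delta}$, uniformly over all $q$, $\mathcal{J}$ and $\mathcal{W}$. *)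

(* Defs.v *)
From HB Require Import structures.
From mathcomp Require Import all_boot all_order all_algebra.
From mathcomp Require Import cyclic.
From mathcomp Require Import all_classical all_reals all_analysis.
From mathcomp Require Import complex.

Set Implicit Arguments.
Unset Strict Implicit.
Unset Printing Implicit Defensive.

Import Order.TTheory GRing.Theory Num.Theory.
Import ComplexField.Normc.

Local Open Scope classical_set_scope.
Local Open Scope ring_scope.
Local Open Scope complex_scope.

(* Characters are extended by 0 to the integers not coprime to q, so that
   chi a <> 0 exactly when a is a unit modulo q; chi 1 = 1 follows. *)
Definition dirichlet_char (R : realType) (q : nat) : set (int -> R[i]) :=
  [set chi | [/\ forall a : int, chi (a + q%:Z) = chi a,
                 forall a b : int, chi (a * b) = chi a * chi b
               & forall a : int, (chi a != 0) = coprimez a q%:Z]].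

Definition induced_from (R : realType) (q d : nat) (chi : int -> R[i]) : Prop :=
  exists psi : int -> R[i],
    dirichlet_char d psi /\
    forall a : int, coprimez a q%:Z -> chi a = psi a.

Definition primitive_char (R : realType) (q : nat) : set (int -> R[i]) :=
  [set chi | dirichlet_char q chi /\
     forall d : nat, (d %| q)%N -> (d < q)%N -> ~ induced_from q d chi].

Definition e_ (R : realType) (q : nat) (z : int) : R[i] :=
  let t := 2 * pi * z%:~R / q%:R in cos t +i* sin t.

(* For q = 1 the only residue is x = 0, which is the unit of Z/1. *)
Definition gauss_sum (R : realType) (q : nat) (chi : int -> R[i]) (n : int)
    : R[i] :=
  \sum_(x < q | coprime x q) chi x%:Z * e_ R q (n * x%:Z).

(* The sums over [primitive_char q] below are finite-support sums, which are
   0 by convention when the support is infinite; for q > 0 this does not occur,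
   by [finite_primitive_char]. *)
Definition wnorm (R : realType) (q : nat) (w : (int -> R[i]) -> R[i]) (s : R)
    : R :=
  (\sum_(chi \in primitive_char q) normc (w chi) `^ s) `^ s^-1.

Definition T_ (R : realType) (q : nat) (w : (int -> R[i]) -> R[i])
    (L N : nat) : R[i] :=
  \sum_(chi \in primitive_char q)
    \sum_(L.+1 <= n < (L + N).+1) w chi * gauss_sum q chi n%:Z.

Lemma dirichlet_char_modz (R : realType) (q : nat) (chi : int -> R[i]) (a : int) :
  dirichlet_char q chi -> chi a = chi (a %% q%:Z)%Z.
Proof.
move=> [per _ _].
have perD (b : int) (k : nat) : chi (b + k%:Z * q%:Z) = chi b.
  elim: k => [|k IH]; first by rewrite mul0r addr0.
  by rewrite -addn1 PoszD mulrDl mul1r addrA per IH.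
rewrite {1}(divz_eq a q%:Z) addrC.
case: (a %/ q%:Z)%Z => k; first exact: perD.
rewrite NegzE -(perD _ k.+1) mulNr.
by rewrite -addrA addNr addr0.
Qed.

Lemma finite_dirichlet_char (R : realType) (q : nat) :
  (0 < q)%N -> finite_set (@dirichlet_char R q).
Proof.
move=> q0.
pose P : {poly R[i]} := 'X * ('X^(totient q) - 1).
have P0 : P != 0.
  rewrite mulf_neq0 ?polyX_eq0 //.
  by rewrite -size_poly_gt0 size_XnsubC ?totient_gt0.
have [s Ps] := closed_field_poly_normal P.
pose f (g : {ffun 'I_q -> seq_sub s}) (a : int) : R[i] :=
  if insub `|(a %% q%:Z)%Z|%N is Some i then val (g i) else 0.
suff sub : dirichlet_char q `<=` range f.
  by apply: sub_finite_set sub _; apply: finite_image; exact: finite_finset.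
move=> chi chiq; have [_ mul nz] := chiq.
have chi1 : chi 1 = 1.
  have c1 : chi 1 != 0 by rewrite nz /coprimez gcd1z.
  by apply: (mulfI c1); rewrite -mul !mulr1.
have chiX (a : int) k : chi (a ^+ k) = chi a ^+ k.
  by elim: k => [|k IH]; rewrite ?expr0 // !exprS mul IH.
have mem (i : 'I_q) : chi i%:Z \in s.
  have : root P (chi i%:Z).
    rewrite /P rootM /root !hornerE.
    case: (boolP (coprimez i%:Z q%:Z)) => [co|nco]; last first.
      by rewrite -nz negbK in nco; rewrite nco.
    apply/orP; right.
    have -> : chi i%:Z ^+ totient q = 1.
      rewrite -chiX -chi1 (dirichlet_char_modz _ chiq) [RHS](dirichlet_char_modz _ chiq).
      congr chi; rewrite -natz -natrX natz !modz_nat.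
      by congr Posz; apply: Euler_exp_totient.
    by rewrite subrr.
  rewrite Ps rootZ ?lead_coef_eq0 // root_prod_XsubC //.
exists [ffun i : 'I_q => SeqSub (mem i)] => //.
apply/funext => a; rewrite /f (dirichlet_char_modz _ chiq).
have m0 : (0 <= (a %% q%:Z)%Z) by rewrite modz_ge0 // eqz_nat -lt0n.
have mq : (`|(a %% q%:Z)%Z| < q)%N by rewrite -ltz_nat gez0_abs // ltz_pmod.
by rewrite (insubT (fun i => (i < q)%N) mq) ffunE /= gez0_abs.
Qed.

Lemma finite_primitive_char (R : realType) (q : nat) :
  (0 < q)%N -> finite_set (@primitive_char R q).
Proof.
move=> q0; suff sub : primitive_char q `<=` @dirichlet_char R q.
  exact: sub_finite_set sub (finite_dirichlet_char R q0).
by move=> chi [].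
Qed.

(* Main.v *)
(* Opening the Gauss sums turns T into the sum over chi of
   omega_chi * (sum over units x of chi(x) gamma(x)), where
   gamma(x) = sum over n in J of e_q(n x) satisfies |gamma(x)| <= min(N, 2q/|x|),
   |x| being the distance from x to the multiples of q.  Hoelder's inequality
   with exponents 2, 4, 4 reduces the claim to the fourth moment of the inner
   sums.  Their squares are character sums over r with coefficients
   F(r) = sum over x y = r (mod q) of gamma(x) gamma(y), so by Bessel's
   inequality the fourth moment is at most q * (sum over r of |F(r)|^2).  In
   F(r), group the pairs by the integer m = |x| |y|, which is r or -r modulo q:
   each m < q^2 arises q^o(1) times with weight at most
   min(2 N q / sqrt m, 4 q^2 / m), so
   |F(r)| <= q^o(1) (N q / sqrt r + N q / sqrt (q - r) + q log q), and the
   fourth moment is at most (N^2 q^3 + q^4) q^o(1). *)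
Require Import Defs.
From mathcomp Require Import all_boot all_order all_algebra.
From mathcomp Require Import cyclic.
From mathcomp Require Import all_classical all_reals all_analysis.
From mathcomp Require Import complex zify ring lra.

Set Implicit Arguments.
Unset Strict Implicit.
Unset Printing Implicit Defensive.

Import Order.TTheory GRing.Theory Num.Theory.
Import ComplexField.Normc.

Local Open Scope ring_scope.

(** * Divisor and harmonic bounds *)

(** Here (e + 1)^k is at most the rising product from e + 1 to e + k, which is k! binom(k + e, k),
    and a binomial coefficient of k + e is at most 2^(k + e). *)
Lemma expn_leq_fact_exp2 (k e : nat) : (e.+1 ^ k <= k`! * 2 ^ k * 2 ^ e)%N.
Proof.
have falling : (e.+1 ^ k <= (e + k) ^_ k)%N.
  elim: k => [|k IH]; first by rewrite ffactn0.
  rewrite addnS ffactnS /= expnS leq_mul //; lia.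
apply: leq_trans falling _.
rewrite -bin_ffact mulnC -mulnA leq_mul2l -expnD addnC.
have /= -> := Pascal 1 1 (k + e).
have lt : (k < (k + e).+1)%N by rewrite ltnS leq_addr.
by rewrite (bigD1 (Ordinal lt)) //= !exp1n !muln1 leq_addr orbT.
Qed.

(** Every divisor of p^e m has the form p^i d with i <= e and d dividing m, so the list [s] of these
    products contains all divisors. *)
Lemma size_divisors_pfactorM (p e m : nat) : prime p -> coprime p m -> (0 < m)%N ->
  (size (divisors (p ^ e * m)) <= e.+1 * size (divisors m))%N.
Proof.
move=> pp copm m0.
have pem0 : (0 < p ^ e * m)%N by rewrite muln_gt0 expn_gt0 prime_gt0.
set s := [seq (p ^ i * d)%N | i <- iota 0 e.+1, d <- divisors m].
have -> : (e.+1 * size (divisors m))%N = size s.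
  by rewrite size_allpairs size_iota.
apply: uniq_leq_size => [|d]; first exact: divisors_uniq.
rewrite -dvdn_divisors // => dv.
have d0 : (0 < d)%N := dvdn_gt0 pem0 dv.
have [d' copd' defd] := pfactor_coprime pp d0.
apply/allpairsP; exists (logn p d, d'); rewrite mem_iota add0n /= ltnS; split.
- have := dvdn_leq_log p pem0 dv.
  by rewrite lognM ?expn_gt0 ?(prime_gt0 pp) // pfactorK // (logn_coprime copm) addn0.
- rewrite -dvdn_divisors // -(@Gauss_dvdr _ (p ^ e)); last first.
    by rewrite coprime_sym coprimeXl.
  by apply: dvdn_trans dv; rewrite defd dvdn_mulr.
- by rewrite {1}defd mulnC.
Qed.

(* Only the primes below 2^k cost a factor: if p >= 2^k, then
   (e + 1)^k <= 2^(k e) <= p^e. *)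
Lemma divisor_bound (k : nat) :
  exists C : nat, forall m, (0 < m)%N -> (size (divisors m) ^ k <= C * m)%N.
Proof.
set K := (k`! * 2 ^ k)%N.
have K0 : (0 < K)%N by rewrite muln_gt0 fact_gt0 expn_gt0.
(* Induction on a strict upper bound [b] for the primes dividing m: a prime below 2^k costs one
   factor [K], a larger one costs nothing, so the exponent of [K] never exceeds 2^k. *)
suff main b m : (0 < m)%N -> (forall p, prime p -> (p %| m)%N -> (p < b)%N) ->
    (size (divisors m) ^ k <= K ^ minn b (2 ^ k) * m)%N.
  exists (K ^ (2 ^ k))%N => m m0.
  apply: (leq_trans (main m.+1 m m0 _)); last by rewrite leq_mul // leq_pexp2l // geq_minr.
  by move=> p _ /(dvdn_leq m0); rewrite ltnS.
elim: b m => [|b IH] m m0 hm.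
  have -> : m = 1%N.
    apply/eqP; apply: contraT => m1.
    have := hm (pdiv m) (pdiv_prime _) (pdiv_dvd m).
    by rewrite ltn0 => ->//; lia.
  by rewrite exp1n muln1 expn_gt0 K0.
have mono : (K ^ minn b (2 ^ k) <= K ^ minn b.+1 (2 ^ k))%N by rewrite leq_pexp2l //; lia.
have [pb|npb] := boolP (prime b); last first.
  apply: (leq_trans (IH m m0 _)) => [p pp pm|]; last by rewrite leq_mul2r mono orbT.
  have := hm p pp pm; rewrite ltnS leq_eqVlt => /orP[/eqP pE|//].
  by rewrite -pE pp in npb.
have [m' com' defm] := pfactor_coprime pb m0.
set e := logn b m in defm.
have m'0 : (0 < m')%N by move: m0; rewrite defm; case: (m').
rewrite defm mulnC.
apply: (@leq_trans ((e.+1 * size (divisors m')) ^ k)).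
  by case: k {K K0 IH mono} => // k; rewrite leq_exp2r // size_divisors_pfactorM.
rewrite expnMn.
have b_m' p : prime p -> (p %| m')%N -> (p < b)%N.
  move=> pp pm'; have := hm p pp; rewrite defm dvdn_mulr // => /(_ isT).
  rewrite ltnS leq_eqVlt => /orP[/eqP pE|//].
  by move: com'; rewrite -pE prime_coprime // pm'.
have {}IH := IH m' m'0 b_m'.
case: (ltnP b (2 ^ k)) => hb.
  have Kle : (e.+1 ^ k <= K * b ^ e)%N.
    apply: leq_trans (expn_leq_fact_exp2 k e) _.
    by rewrite leq_mul //; case: (e) => // j; rewrite leq_exp2r ?prime_gt1.
  have -> : minn b.+1 (2 ^ k) = (minn b (2 ^ k)).+1 by lia.
  rewrite expnS; apply: leq_trans (leq_mul Kle IH) _.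
  by rewrite mulnACA.
have Kle : (e.+1 ^ k <= b ^ e)%N.
  apply: (@leq_trans ((2 ^ e) ^ k)%N).
    by case: (k) => // j; rewrite leq_exp2r // ltn_expl.
  rewrite -expnM mulnC expnM; case: (e) => // j; by rewrite leq_exp2r.
apply: leq_trans (leq_mul Kle IH) _.
by rewrite mulnCA leq_mul2r mono orbT.
Qed.

(** Telescoping: ln(1 + x) <= x at x = -1/(n + 2) gives 1/(n + 2) <= ln(n + 2) - ln(n + 1). *)
Lemma harmonic_le_ln (R : realType) (n : nat) : (0 < n)%N ->
  \sum_(k < n) k.+1%:R^-1 <= 1 + ln n%:R :> R.
Proof.
case: n => // n _; elim: n => [|n IH].
  by rewrite big_ord_recl big_ord0 ln1 invr1.
rewrite big_ord_recr /=.
suff h : n.+2%:R^-1 <= ln n.+2%:R - ln n.+1%:R :> R.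
  by apply: le_trans (lerD IH h) _; rewrite -addrA subrKC.
rewrite -ln_div ?posrE ?ltr0n//.
have h : 1 + - n.+2%:R^-1 = (n.+2%:R / n.+1%:R)^-1 :> R.
  have id (x : R) : x + 1 != 0 -> 1 - (x + 1)^-1 = x / (x + 1) by move=> ?; field.
  by rewrite invf_div -(natr1 n.+1); apply: id; rewrite natr1 pnatr_eq0.
have /le_ln1Dx : -1 < - n.+2%:R^-1 :> R by rewrite ltrN2 invf_lt1 ?ltr1n.
by rewrite h lnV ?posrE ?divr_gt0 ?ltr0n // lerN2.
Qed.

Lemma ln_le_powR (R : realType) (d x : R) : 0 < d -> 0 < x -> ln x <= d^-1 * x `^ d.
Proof.
move=> d0 x0; rewrite mulrC ler_pdivlMr // mulrC -ln_powR.
have := @ln_sublinear R (x `^ d); rewrite powR_gt0 // => /(_ isT); lra.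
Qed.

(** * The large sieve for Dirichlet characters *)

(** Let c_a be the inner sum for a, p = sum_a conj(c_a) u_a, and S = sum_a |c_a|^2. Orthogonality
    gives sum p F = S and sum |p|^2 = n S, so expanding sum |n conj(F) - p|^2 >= 0 yields n (n sum
    |F|^2 - S) >= 0. *)
Lemma bessel (C : numClosedFieldType) (I : finType) (P : pred I) (T : eqType)
    (u : T -> I -> C) (s : seq T) (n : C) (F : I -> C) :
  uniq s -> 0 < n ->
  {in s &, forall a b, \sum_(i | P i) u a i * (u b i)^* = (if a == b then n else 0)} ->
  \sum_(a <- s) `|\sum_(i | P i) u a i * F i| ^+ 2 <=
    n * \sum_(i | P i) `|F i| ^+ 2.
Proof.
move=> us n0 ortho.
pose c a := \sum_(i | P i) u a i * F i.
pose p i := \sum_(a <- s) (c a)^* * u a i.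
set S := (X in X <= _).
have SE : S = \sum_(a <- s) c a * (c a)^* by apply: eq_bigr => a _; rewrite normCK.
have n_real : n^* = n by rewrite conj_Creal // gtr0_real.
have S_real : S^* = S.
  by rewrite SE rmorph_sum /=; apply: eq_bigr => a _; rewrite rmorphM /= conjCK mulrC.
have pF : \sum_(i | P i) p i * F i = S.
  under eq_bigr do rewrite mulr_suml.
  rewrite exchange_big SE; apply: eq_bigr => a _ /=.
  by rewrite mulrC mulr_sumr; apply: eq_bigr => i _; rewrite mulrA.
have pp : \sum_(i | P i) p i * (p i)^* = n * S.
  have ppE i : p i * (p i)^* =
      \sum_(a <- s) \sum_(b <- s) (c a)^* * c b * (u a i * (u b i)^*).
    rewrite mulr_suml; apply: eq_bigr => a _.
    have -> : (p i)^* = \sum_(b <- s) c b * (u b i)^*.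
      by rewrite rmorph_sum; apply: eq_bigr => b _; rewrite rmorphM /= conjCK.
    by rewrite mulr_sumr; apply: eq_bigr => b _; rewrite mulrACA.
  under eq_bigr do rewrite ppE.
  rewrite exchange_big SE mulr_sumr [LHS]big_seq [RHS]big_seq; apply: eq_bigr => a sa /=.
  rewrite exchange_big (bigD1_seq a) //= [X in _ + X]big_seq_cond [X in _ + X]big1 => [|b /andP[sb ba]]; last first.
    by rewrite -mulr_sumr ortho // eq_sym (negbTE ba) mulr0.
  by rewrite addr0 -mulr_sumr ortho // eqxx [c a * _]mulrC [RHS]mulrC.
have : 0 <= \sum_(i | P i) `|n * (F i)^* - p i| ^+ 2.
  by apply: sumr_ge0 => i _; rewrite exprn_ge0.
have -> : \sum_(i | P i) `|n * (F i)^* - p i| ^+ 2 =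
    n * (n * \sum_(i | P i) `|F i| ^+ 2 - S).
  have E i : `|n * (F i)^* - p i| ^+ 2 =
      n * n * `|F i| ^+ 2 - n * (p i * F i)^* - n * (p i * F i) + p i * (p i)^*.
    by rewrite !normCK rmorphB !rmorphM /= conjCK n_real /=; ring.
  under eq_bigr do rewrite E.
  rewrite big_split /= !sumrB -!mulr_sumr -rmorph_sum pF pp /= S_real; ring.
by rewrite pmulr_rge0 // subr_ge0.
Qed.

Section DirichletCharacters.
Variables (R : realType) (q : nat).
Hypothesis q_gt0 : (0 < q)%N.
Implicit Type chi psi : int -> R[i].

Lemma dirichlet_char1 chi : dirichlet_char q chi -> chi 1 = 1.
Proof.
move=> [_ mul nz].
have c1 : chi 1 != 0 by rewrite nz /coprimez gcd1z.
by apply: (mulfI c1); rewrite -mul !mulr1.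
Qed.

Lemma dirichlet_charX chi (a : int) k :
  dirichlet_char q chi -> chi (a ^+ k) = chi a ^+ k.
Proof.
move=> chiq; have [_ mul _] := chiq.
by elim: k => [|k IH]; rewrite ?expr0 ?dirichlet_char1 // !exprS mul IH.
Qed.

(** By Euler's theorem chi(a) is a root of unity of order dividing [totient q]. *)
Lemma norm_dirichlet_char chi (a : nat) :
  dirichlet_char q chi -> coprime a q -> `|chi a%:Z| = 1.
Proof.
move=> chiq co.
have : chi a%:Z ^+ totient q = 1.
  rewrite -dirichlet_charX // -[RHS](dirichlet_char1 chiq).
  rewrite (dirichlet_char_modz _ chiq) [RHS](dirichlet_char_modz _ chiq).
  congr chi; rewrite -natz -natrX natz !modz_nat.
  by congr Posz; apply: Euler_exp_totient.
move/(congr1 Num.norm); rewrite normrX normr1 => /eqP.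
by rewrite pexprn_eq1 // -leqn0 leqNgt totient_gt0 q_gt0 => /eqP.
Qed.

Lemma dirichlet_char_mul_conj chi psi : dirichlet_char q chi ->
  dirichlet_char q psi -> dirichlet_char q (fun a => chi a * (psi a)^*).
Proof.
move=> [per mul nz] [per' mul' nz']; split=> [a|a b|a].
- by rewrite per per'.
- by rewrite mul mul' rmorphM mulrACA.
- by rewrite mulf_eq0 negb_or conjC_eq0 nz nz' andbb.
Qed.

Lemma sum_unit_reindex (f : int -> R[i]) (a : nat) :
  (forall x : nat, f (x %% q)%N = f x) -> coprime a q ->
  \sum_(x < q | coprime x q) f (a * x)%N = \sum_(x < q | coprime x q) f x.
Proof.
move=> per co.
pose h (x : 'I_q) := Ordinal (ltn_pmod (a * x) q_gt0).
have h_inj : injective h.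
  move=> x y [/eqP]; wlog xy : x y / (x <= y)%N.
    move=> H; case: (leqP x y) => [|/ltnW] le; first exact: H.
    by rewrite eq_sym => /(H _ _ le) ->.
  rewrite eq_sym eqn_mod_dvd ?leq_mul // -mulnBr Gauss_dvdr 1?coprime_sym // => dv.
  apply/val_inj/eqP; rewrite /= eqn_leq xy -subn_eq0; apply: contraT.
  rewrite -lt0n => /dvdn_leq /(_ dv).
  have := ltn_ord y; lia.
rewrite [RHS](reindex_inj h_inj) /=.
apply: eq_big => [x|x _]; last by rewrite per.
by rewrite coprime_modl coprimeMl co.
Qed.

(** The substitution x -> a x permutes the units and multiplies the sum by chi(a), which differs
    from 1. *)
Lemma sum_dirichlet_char0 chi (a : nat) : dirichlet_char q chi ->
  coprime a q -> chi a != 1 -> \sum_(x < q | coprime x q) chi x = 0.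
Proof.
move=> chiq co ne; have [_ mul _] := chiq.
apply/eqP; rewrite -(mulrI_eq0 _ (mulfI _ : GRing.lreg (chi a - 1))) ?subr_eq0 //.
rewrite mulrBl mul1r subr_eq0 -[eqbRHS](@sum_unit_reindex _ a) //; last first.
  by move=> x; rewrite [RHS](dirichlet_char_modz _ chiq) modz_nat.
by rewrite mulr_sumr; apply/eqP/eq_bigr => x _; rewrite PoszM mul.
Qed.

(** Distinct characters differ at some residue, which is a unit since both vanish elsewhere. There
    chi conj(psi) is not 1, because |psi| = 1 on units, so its sum vanishes. *)
Lemma dirichlet_char_ortho chi psi : dirichlet_char q chi ->
  dirichlet_char q psi ->
  \sum_(x < q | coprime x q) chi x * (psi x)^* =
    (if chi == psi then (totient q)%:R else 0).
Proof.
move=> chiq psiq; case: eqP => [<-|ne].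
  rewrite -(@eq_bigr _ _ _ _ _ _ (fun=> 1)) => [|x co]; last first.
    by rewrite -normCK norm_dirichlet_char // expr1n.
  rewrite sumr_const totient_count_coprime big_mkord -sum1_card big_mkcond.
  congr _%:R; apply: eq_bigr => x _.
  by rewrite coprime_sym unfold_in /coprime eqE /=; case: eqn.
have [a /eqP ane] : exists a, chi a <> psi a.
  by apply/existsNP => H; apply: ne; apply/funext.
have [n an] : exists n : nat, (a %% q%:Z)%Z = n.
  exists `|(a %% q%:Z)%Z|%N; rewrite gez0_abs // modz_ge0 // eqz_nat -lt0n //.
move: ane; rewrite (dirichlet_char_modz _ chiq) (dirichlet_char_modz _ psiq) an => ane.
have co : coprime n q.
  apply: contraT => nco.
  have zero f : dirichlet_char q f -> f n = 0.
    by move=> [_ _ nz]; apply/eqP; rewrite -[_ == _]negbK nz; exact: nco.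
  by rewrite !zero ?eqxx in ane.
apply: (sum_dirichlet_char0 (dirichlet_char_mul_conj chiq psiq) co).
apply: contra ane => /eqP e1; apply/eqP.
have p0 : (psi n)^* != 0.
  by rewrite conjC_eq0 -normr_gt0 norm_dirichlet_char.
by apply: (mulIf p0); rewrite e1 -normCK norm_dirichlet_char // expr1n.
Qed.

(** Bessel's inequality for the characters, orthogonal with squared norm [totient q], followed by
    [totient q] <= q. *)
Lemma dirichlet_char_large_sieve (s : seq (int -> R[i])) (F : nat -> R[i]) :
  uniq s -> {in s, forall chi, dirichlet_char q chi} ->
  \sum_(chi <- s) normc (\sum_(x < q | coprime x q) chi x * F x) ^+ 2 <=
    q%:R * \sum_(x < q | coprime x q) normc (F x) ^+ 2.
Proof.
move=> us sq.
apply: (@le_trans _ _ ((totient q)%:R * \sum_(x < q | coprime x q) normc (F x) ^+ 2)).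
  rewrite -lecR rmorph_sum rmorphM rmorph_nat rmorph_sum /=.
  under eq_bigr do rewrite rmorphXn.
  under [in X in _ <= X]eq_bigr do rewrite rmorphXn.
  apply: (@bessel _ _ _ _ (fun chi (x : 'I_q) => chi x)) => //.
    by rewrite ltr0n totient_gt0.
  by move=> chi psi /sq chiq /sq psiq; exact: dirichlet_char_ortho.
apply: ler_wpM2r; first by apply: sumr_ge0 => x _; rewrite sqr_ge0.
rewrite ler_nat.
rewrite -[leqRHS]card_ord -sum1_card totient_count_coprime big_mkord.
by apply: leq_sum => x _; case: coprime.
Qed.

End DirichletCharacters.

(** * Exponential sums over an interval *)

Lemma normc_sum (R : rcfType) (I : Type) (r : seq I) (P : pred I) (F : I -> R[i]) :
  normc (\sum_(i <- r | P i) F i) <= \sum_(i <- r | P i) normc (F i).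
Proof. by rewrite -lecR rmorph_sum /=; exact: (ler_norm_sum r F P). Qed.

Lemma normc_ge0 (R : rcfType) (z : R[i]) : 0 <= normc z.
Proof. by rewrite -lecR; exact: (normr_ge0 z). Qed.

Lemma normcX (R : rcfType) (z : R[i]) n : normc (z ^+ n) = normc z ^+ n.
Proof. by elim: n => [|n IH]; rewrite ?expr0 ?normc1 // !exprS normcM IH. Qed.

(* If Re (z^m) <= 0 then |1 - z^m| >= 1, while |1 - z^m| <= m |1 - z|. *)
Lemma normc_subr1_ge (R : rcfType) (z : R[i]) (m : nat) :
  normc z = 1 -> complex.Re (z ^+ m) <= 0 -> 1 <= m%:R * normc (z - 1).
Proof.
move=> z1 zm.
have h : 1 <= normc (z ^+ m - 1).
  rewrite -lecR; apply: le_trans (normc_ge_Re _); rewrite lecR.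
  case: (z ^+ m) zm => a b /= a0.
  by rewrite ler0_norm; lra.
apply: le_trans h _; rewrite subrX1 normcM mulrC ler_wpM2r ?normc_ge0 //.
apply: le_trans (normc_sum _ _ _) _.
rewrite (eq_bigr (fun=> 1)) => [|i _]; last by rewrite normcX z1 expr1n.
by rewrite sumr_const card_ord.
Qed.

Section ExponentialSums.
Variable (R : realType) (q : nat).
Hypothesis q_gt0 : (0 < q)%N.
Local Notation e := (@e_ R q).

Lemma e_0 : e 0 = 1.
Proof. by rewrite /e_ mulr0 mul0r cos0 sin0. Qed.

Lemma e_D a b : e (a + b) = e a * e b.
Proof.
rewrite /e_ rmorphD /= mulrDr mulrDl cosD sinD.
by apply/eqP; rewrite eq_complex /= eqxx [sin _ * cos _]mulrC addrC eqxx.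
Qed.

Lemma normc_e a : normc (e a) = 1.
Proof. by rewrite /e_ /= cos2Dsin2 sqrtr1. Qed.

Lemma e_N a : e (- a) = (e a)^*%C.
Proof. by rewrite /e_ rmorphN mulrN mulNr cosN sinN. Qed.

Lemma e_q : e q%:Z = 1.
Proof.
rewrite /e_ -mulrA divff ?pnatr_eq0 -?lt0n // mulr1.
by rewrite mulrC mulr_natr cos2pi sin2pi.
Qed.

Lemma e_X (x : int) n : e (n%:Z * x) = e x ^+ n.
Proof.
elim: n => [|n IH]; first by rewrite mul0r e_0.
by rewrite -add1n PoszD mulrDl mul1r e_D IH exprS.
Qed.

(** The coefficient gamma(x) of chi(x) once the Gauss sums are opened. *)
Definition interval_sum (L N x : nat) : R[i] :=
  \sum_(L.+1 <= n < (L + N).+1) e (n%:Z * x%:Z).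

Lemma interval_sum_le_N L N x : normc (interval_sum L N x) <= N%:R.
Proof.
apply: le_trans (normc_sum _ _ _) _.
rewrite (eq_bigr (fun=> 1)) => [|i _]; last exact: normc_e.
by rewrite sumr_const_nat subSS addKn.
Qed.

(** The hypotheses place the angle 2 pi k / q in [pi/2, 3 pi/2]. *)
Lemma Re_e_le0 (k : nat) : (q <= 4 * k)%N -> (4 * k <= 3 * q)%N ->
  complex.Re (e k) <= 0.
Proof.
move=> h1 h2; rewrite /e_ /=.
set t := _ / _.
have pi0 := pi_gt0 R.
have q0 : 0 < q%:R :> R by rewrite ltr0n.
have tq : t * q%:R = 2 * pi * k%:R by rewrite divfK // gt_eqF.
have k1 : q%:R <= 4 * k%:R :> R by rewrite -natrM ler_nat.
have k2 : 4 * k%:R <= 3 * q%:R :> R by rewrite -!natrM ler_nat.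
have -> : t = (t - pi) + pi by rewrite subrK.
rewrite cosDpi oppr_le0 cos_ge0_pihalf //; apply/andP; split.
  rewrite -(ler_pM2r q0) mulrBl tq; nra.
by rewrite -(ler_pM2r q0) mulrBl tq; nra.
Qed.

(** With z = e_q(x), the geometric series gives |gamma(x)| |z - 1| <= 2. The hypotheses make Re(z^m)
    <= 0, hence 1 <= m |z - 1|; no lower bound for the sine is required. *)
Lemma interval_sum_geom L N x (m : nat) :
  (q <= 4 * (m * x))%N -> (4 * (m * x) <= 3 * q)%N ->
  normc (interval_sum L N x) <= 2 * m%:R.
Proof.
move=> h1 h2.
set z := e x%:Z.
have z1 : normc z = 1 := normc_e _.
have zm : complex.Re (z ^+ m) <= 0 by rewrite -e_X -PoszM Re_e_le0.
have := normc_subr1_ge z1 zm; set a := normc (z - 1) => h.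
have gE : interval_sum L N x = z ^+ L.+1 * \sum_(i < N) z ^+ i.
  rewrite /interval_sum -addSn -{1}[L.+1]add0n big_addn addKn big_mkord mulr_sumr.
  by apply: eq_bigr => i _; rewrite e_X exprD mulrC.
have b : normc (interval_sum L N x) * a <= 2.
  rewrite gE mulrC /a normcM normcX z1 expr1n mul1r -normcM -subrX1.
  by apply: le_trans (le_normcD _ _) _; rewrite normcN normc1 normcX z1 expr1n.
have n0 := normc_ge0 (interval_sum L N x).
have m0 : 0 <= m%:R :> R by [].
nra.
Qed.

Lemma interval_sumC L N x : (x <= q)%N ->
  normc (interval_sum L N (q - x)) = normc (interval_sum L N x).
Proof.
move=> xq.
have -> : interval_sum L N (q - x) = (interval_sum L N x)^*%C.
  rewrite /interval_sum rmorph_sum; apply: eq_bigr => n _ /=.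
  by rewrite -subzn // mulrBr e_D e_X e_q expr1n mul1r e_N.
by case: (interval_sum L N x) => a b /=; rewrite sqrrN.
Qed.

Lemma interval_sum_le_inv L N x : (0 < x < q)%N ->
  normc (interval_sum L N x) <= 2 * q%:R / (minn x (q - x))%:R.
Proof.
(* Both sides are invariant under x -> q - x, which conjugates the interval sum. *)
move=> /andP[x0 xq]; wlog xle : x x0 xq / (2 * x <= q)%N.
  move=> H; have [/H -> //|lt] := leqP (2 * x) q.
  have -> : minn x (q - x) = minn (q - x) (q - (q - x)) by lia.
  by rewrite -interval_sumC 1?ltnW //; apply: H; lia.
have -> : minn x (q - x) = x by lia.
have x40 : (0 < 4 * x)%N by lia.
(* The least m with 4 m x > q. As 2 x <= q, it satisfies 4 m x <= q + 4 x <= 3 q and m x <= q, so 2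
   m <= 2 q / x. *)
pose m := (q %/ (4 * x)).+1.
have h1 := ltn_ceil q x40; have h2 := leq_divM q (4 * x).
have hm : (m * x <= q)%N by rewrite /m; nia.
apply: le_trans (@interval_sum_geom L N x m _ _) _; rewrite /m; [nia|nia|].
rewrite ler_pdivlMr ?ltr0n // -mulrA ler_wpM2l // -natrM ler_nat; exact: hm.
Qed.
End ExponentialSums.

(** * The multiplicative convolution *)

(* The absolute value of the representative of x of least absolute value, for
   x <= q. *)
Definition abs_mod (q x : nat) : nat := minn x (q - x).

(** A pair (x, y) is determined by |x|, which divides m, and by the halves of [0, q) containing x
    and y: since m > 0, |x| is nonzero and fixes |y|. *)
Lemma card_abs_mod_mul (q m : nat) : (0 < m)%N ->
  (#|[pred p : 'I_q * 'I_q | abs_mod q p.1 * abs_mod q p.2 == m]%N|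
     <= 4 * size (divisors m))%N.
Proof.
move=> m0; set A := [pred p | _].
pose f (p : 'I_q * 'I_q) := (abs_mod q p.1, ((p.1 <= q - p.1)%N, (p.2 <= q - p.2)%N)).
pose s := [seq (d, c) | d <- divisors m,
  c <- [:: (true, true); (true, false); (false, true); (false, false)]].
have -> : (4 * size (divisors m))%N = size s by rewrite size_allpairs mulnC.
rewrite cardE -(size_map f); apply: uniq_leq_size.
  rewrite map_inj_in_uniq ?enum_uniq // => -[x y] [x' y'].
  rewrite !mem_enum !inE /f /= => /eqP E /eqP E' [eqx cx cy].
  have eqy : abs_mod q y = abs_mod q y'.
    apply/eqP; rewrite -(@eqn_pmul2l (abs_mod q x)); first by rewrite E eqx E'.
    by rewrite lt0n; apply: contraTneq m0 => x0; rewrite -E x0.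
  have lx := ltn_ord x; have ly := ltn_ord y.
  have lx' := ltn_ord x'; have ly' := ltn_ord y'.
  have ox : x = x' :> nat by move: eqx cx; rewrite /abs_mod; lia.
  have oy : y = y' :> nat by move: eqy cy; rewrite /abs_mod; lia.
  by rewrite (val_inj ox) (val_inj oy).
move=> z /mapP[[x y] + ->]; rewrite mem_enum inE /= => /eqP E {z}.
apply/allpairsP; exists (abs_mod q x, ((x <= q - x)%N, (y <= q - y)%N)); split => //=.
  by rewrite -dvdn_divisors // -E dvdn_mulr.
by case: (_ <= _)%N; case: (_ <= _)%N.
Qed.

(** Replacing a factor z by q - z changes the residue of the product from r to q - r; doing so for
    both factors restores r. *)
Lemma abs_mod_mul_modn (q r x y : nat) : (0 < r < q)%N -> (x < q)%N -> (y < q)%N ->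
  (x * y %% q == r)%N ->
  ((abs_mod q x * abs_mod q y) %% q == r)%N ||
  ((abs_mod q x * abs_mod q y) %% q == q - r)%N.
Proof.
move=> /andP[r0 rq] xq yq /eqP xy.
have cross z t : (z <= q)%N -> (z * t %% q = r)%N -> ((q - z) * t %% q = q - r)%N.
  move=> zq zt.
  have : (((q - z) * t + z * t) %% q = 0)%N by rewrite -mulnDl subnK // modnMr.
  rewrite -modnDmr zt -modnDml => E.
  have l : ((q - z) * t %% q < q)%N by rewrite ltn_mod; lia.
  move: E l; set w := ((q - z) * t %% q)%N => E l.
  have [lt|ge] := ltnP (w + r) q; first by move: E; rewrite modn_small //; lia.
  have : (w + r = (w + r - q) + q)%N by lia.
  move=> E2; move: E; rewrite E2 modnDr modn_small; lia.
have crossr z t : (t <= q)%N -> (z * t %% q = r)%N -> (z * (q - t) %% q = q - r)%N.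
  by move=> tq zt; rewrite mulnC; apply: cross => //; rewrite mulnC.
rewrite /abs_mod /minn; case: ifP => _; case: ifP => _.
- by rewrite xy eqxx.
- by rewrite crossr ?eqxx ?orbT // ltnW.
- by rewrite cross ?eqxx ?orbT // ltnW.
- have lt : (q - r <= q)%N by lia.
  have : ((q - x) * (q - y) %% q = r)%N.
    have c1 := cross x y (ltnW xq) xy.
    have : (((q - x) * (q - y) + (q - x) * y) %% q = 0)%N.
      by rewrite -mulnDr subnK 1?ltnW // modnMl.
    rewrite -modnDmr c1 -modnDml => E.
    have l : ((q - x) * (q - y) %% q < q)%N by rewrite ltn_mod; lia.
    move: E l; set w := ((q - x) * (q - y) %% q)%N => E l.
    have [lt'|ge] := ltnP (w + (q - r)) q; first by move: E; rewrite modn_small //; lia.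
    have : (w + (q - r) = (w + (q - r) - q) + q)%N by lia.
    by move=> E2; move: E; rewrite E2 modnDr modn_small; lia.
  by move=> ->; rewrite eqxx.
Qed.

Lemma sum_inv_le_harmonic (R : numFieldType) (n : nat) :
  \sum_(k < n | k != 0%N :> nat) k%:R^-1 <= \sum_(k < n) k.+1%:R^-1 :> R.
Proof.
case: n => [|n]; first by rewrite !big_ord0.
rewrite big_mkcond big_ord_recl /= add0r big_ord_recr /=.
by rewrite lerDl invr_ge0.
Qed.

Section Convolution.
(** [b] stands for |gamma| and [D] for a bound on the number of divisors of the integers up to
    q^2. *)
Variables (R : realType) (q N : nat) (b : nat -> R) (D : nat).
Hypothesis b_ge0 : forall x, 0 <= b x.
Hypothesis b_le_N : forall x, b x <= N%:R.
Hypothesis b_le_inv : forall x, (0 < x < q)%N -> b x <= 2 * q%:R / (abs_mod q x)%:R.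
Hypothesis divisors_le : forall m, (0 < m <= q ^ 2)%N -> (size (divisors m) <= D)%N.

Let H : R := \sum_(k < q) k.+1%:R^-1.

(* Bounds b x * b y when the product of the absolute values is k q + s. *)
Let V (k s : nat) : R :=
  if k == 0%N then 2 * N%:R * q%:R / Num.sqrt s%:R else 4 * q%:R / k%:R.

Let V_ge0 k s : 0 <= V k s.
Proof. by rewrite /V; case: eqP => _; rewrite !mulr_ge0 ?invr_ge0 ?sqrtr_ge0. Qed.

(** Let u = |x| and v = |y|. If u v < q, use the bound N at the smaller of u, v and 2 q / max(u, v)
    at the larger, which is at least sqrt(u v). Otherwise 4 q^2 / (u v) <= 4 q / k, because k q <= u
    v. *)
Lemma mul_weight_le x y : (0 < x < q)%N -> (0 < y < q)%N ->
  b x * b y <= V (abs_mod q x * abs_mod q y %/ q) (abs_mod q x * abs_mod q y %% q).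
Proof.
move=> hx hy.
have ax0 : (0 < abs_mod q x)%N by rewrite /abs_mod; lia.
have ay0 : (0 < abs_mod q y)%N by rewrite /abs_mod; lia.
have bx := b_le_inv hx; have by_ := b_le_inv hy.
move: (abs_mod q x) (abs_mod q y) ax0 ay0 bx by_ => u v u0 v0 bx by_.
have q0 : (0 < q)%N by lia.
rewrite /V -leqn0 leqNgt divn_gt0 // -ltnNge.
case: ltnP => [lt|ge].
  rewrite modn_small //.
  have main u' v' x' y' : (0 < u')%N -> (0 < v')%N -> (u' <= v')%N ->
      b y' <= 2 * q%:R / v'%:R ->
      b x' * b y' <= 2 * N%:R * q%:R / Num.sqrt (u' * v')%:R.
    move=> u'0 v'0 uv by'.
    apply: le_trans (ler_pM (b_ge0 _) (b_ge0 _) (b_le_N _) by') _.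
    rewrite mulrA [N%:R * _]mulrCA -[2 * N%:R * _]mulrA.
    rewrite ler_wpM2l ?mulr_ge0 // lef_pV2 ?posrE ?sqrtr_gt0 ?ltr0n ?muln_gt0 ?u'0 //.
    rewrite -[leRHS]ger0_norm // -sqrtr_sqr ler_wsqrtr // -natrX ler_nat -mulnn.
    by rewrite leq_mul2r uv orbT.
  have [uv|/ltnW vu] := leqP u v; first exact: main.
  by rewrite mulrC mulnC; exact: main.
apply: le_trans (ler_pM (b_ge0 _) (b_ge0 _) bx by_) _.
have k0 : (0 < u * v %/ q)%N by rewrite divn_gt0.
have km := leq_divM (u * v) q.
rewrite mulrACA -invfM -[u%:R * _]natrM.
rewrite ler_pdivrMr ?ltr0n ?muln_gt0 ?u0 //. rewrite [leRHS]mulrAC ler_pdivlMr ?ltr0n //.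
have : (u * v %/ q)%:R * q%:R <= (u * v)%:R :> R by rewrite -natrM ler_nat.
move: (u * v %/ q)%N (u * v)%N => k m h.
have : 0 <= (4 * q%:R : R) by rewrite mulr_ge0.
nra.
Qed.

(** Split by the quotient k < q. Each integer k q + s <= q^2 comes from at most 4 [D] pairs; k = 0
    gives the square-root term and k >= 1 the harmonic sum. *)
Lemma sum_residue_le s : (0 < s < q)%N ->
  \sum_(p : 'I_q * 'I_q | (abs_mod q p.1 * abs_mod q p.2 %% q == s)%N)
     V (abs_mod q p.1 * abs_mod q p.2 %/ q) s
  <= 4 * D%:R * (2 * N%:R * q%:R / Num.sqrt s%:R + 4 * q%:R * H).
Proof.
move=> /andP[s0 sq].
have q0 : (0 < q)%N by lia.
have quot_lt (p : 'I_q * 'I_q) : (abs_mod q p.1 * abs_mod q p.2 %/ q < q)%N.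
  rewrite ltn_divLR //; apply: ltn_mul.
    by have := ltn_ord p.1; rewrite /abs_mod; lia.
  by have := ltn_ord p.2; rewrite /abs_mod; lia.
rewrite (partition_big (fun p => Ordinal (quot_lt p)) predT) //=.
apply: (@le_trans _ _ (\sum_(k < q) 4 * D%:R * V k s)).
  apply: ler_sum => k _.
  set m := (k * q + s)%N.
  rewrite (eq_bigl (mem [pred p : 'I_q * 'I_q | abs_mod q p.1 * abs_mod q p.2 == m]%N)); last first.
    move=> p; rewrite !inE -val_eqE /=; apply/idP/idP.
      by move=> /andP[/eqP es /eqP ek]; rewrite /m -es -ek -divn_eq.
    by move=> /eqP ->; rewrite /m modnMDl modn_small // divnMDl // divn_small // addn0 !eqxx.
  rewrite (eq_bigr (fun=> V k s)) => [|p]; last first.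
    by rewrite inE => /eqP ->; rewrite /m divnMDl // divn_small // addn0.
  rewrite sumr_const -[leLHS]mulr_natl ler_wpM2r ?V_ge0 // -natrM ler_nat.
  have m0 : (0 < m)%N by rewrite /m; lia.
  apply: leq_trans (card_abs_mod_mul q m0) _; rewrite leq_mul2l divisors_le ?orbT //.
  by rewrite m0 /m -mulnn; have := ltn_ord k; nia.
rewrite -mulr_sumr ler_wpM2l ?mulr_ge0 //.
rewrite (bigD1 (Ordinal q0)) //= {1}/V eqxx lerD2l /H.
rewrite (eq_bigr (fun k : 'I_q => 4 * q%:R * k%:R^-1)) => [|k]; last first.
  by rewrite -val_eqE /= /V => /negbTE ->.
rewrite -mulr_sumr ler_wpM2l ?mulr_ge0 //.
rewrite (eq_bigl (fun k : 'I_q => k != 0%N :> nat)) => [|k]; last by rewrite -val_eqE.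
exact: sum_inv_le_harmonic.
Qed.

(** With b = |gamma| this majorizes |F(r)|. *)
Definition mul_convolution (r : nat) : R :=
  \sum_(x < q | coprime x q) \sum_(y < q | coprime y q && (x * y %% q == r)%N)
    b x * b y.

(** The product |x| |y| of each contributing pair is r or q - r modulo q, so the bounds for these
    two residues add up. *)
Lemma mul_convolution_le r : (0 < r < q)%N ->
  mul_convolution r <= 8 * D%:R *
    (N%:R * q%:R / Num.sqrt r%:R + N%:R * q%:R / Num.sqrt (q - r)%:R + 4 * q%:R * H).
Proof.
move=> /andP[r0 rq].
have pos (x : 'I_q) : coprime x q -> (0 < x < q)%N.
  rewrite ltn_ord andbT lt0n; case: eqP => // ->; rewrite /coprime gcd0n; lia.
have sr := @sum_residue_le r; have sqr := @sum_residue_le (q - r).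
rewrite r0 rq in sr; have {}sr := sr isT.
have {}sqr := sqr ltac:(lia).
rewrite /mul_convolution pair_big_dep /=.
pose m (p : 'I_q * 'I_q) := (abs_mod q p.1 * abs_mod q p.2)%N.
apply: (@le_trans _ _ (\sum_(p : 'I_q * 'I_q | (m p %% q == r)%N) V (m p %/ q) r +
    \sum_(p : 'I_q * 'I_q | (m p %% q == q - r)%N) V (m p %/ q) (q - r))).
  rewrite [X in _ <= X + _]big_mkcond [X in _ <= _ + X]big_mkcond -big_split big_mkcond /=.
  apply: ler_sum => -[x y] _ /=.
  case: ifP => [/and3P[cx cy xy]|_]; last first.
    by rewrite addr_ge0 //; case: ifP.
  have := mul_weight_le (pos _ cx) (pos _ cy).
  have := @abs_mod_mul_modn q r x y; rewrite r0 rq !ltn_ord xy /m /=.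
  move=> /(_ isT isT isT isT) /orP[] /eqP -> le1.
    by rewrite eqxx (le_trans le1) // lerDl; case: ifP.
  by rewrite eqxx (le_trans le1) // lerDr; case: ifP.
by apply: le_trans (lerD sr sqr) _; rewrite /m; lra.
Qed.

Let H_ge1 : (0 < q)%N -> 1 <= H.
Proof.
rewrite /H; case: (q) => // n _; rewrite big_ord_recl invr1 lerDl.
by apply: sumr_ge0 => i _; rewrite invr_ge0.
Qed.

(** Squaring the pointwise bound with (u + v + w)^2 <= 3 (u^2 + v^2 + w^2) gives 192 = 3 * 8^2 and
    turns the square roots into [A] / r and [A] / (q - r), each summing to at most [A * H]. *)
Lemma sum_sqr_mul_convolution_le : (1 < q)%N ->
  \sum_(r < q | coprime r q) mul_convolution r ^+ 2 <=
    (96 * D%:R * H) ^+ 2 * (N%:R ^+ 2 * q%:R ^+ 2 + q%:R ^+ 3).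
Proof.
move=> q1; have q0 : (0 < q)%N by lia.
have H1 := H_ge1 q0; have H0 : 0 <= H := le_trans ler01 H1.
have pos (x : 'I_q) : coprime x q -> (0 < x < q)%N.
  rewrite ltn_ord andbT lt0n; case: eqP => // ->; rewrite /coprime gcd0n; lia.
pose A : R := N%:R ^+ 2 * q%:R ^+ 2.
have A0 : 0 <= A by rewrite mulr_ge0 ?exprn_ge0.
have conv_ge0 r : 0 <= mul_convolution r.
  by rewrite sumr_ge0 // => x _; rewrite sumr_ge0 // => y _; rewrite mulr_ge0.
have sqrt_inv (n : nat) : (0 < n)%N -> (N%:R * q%:R / Num.sqrt n%:R) ^+ 2 = A / n%:R :> R.
  by move=> n0; rewrite expr_div_n exprMn sqr_sqrtr.
have pointwise (r : 'I_q) : coprime r q -> mul_convolution r ^+ 2 <=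
    192 * D%:R ^+ 2 * (A / r%:R + A / (q - r)%:R + 16 * (q%:R ^+ 2 * H ^+ 2)).
  move=> /pos rq; have le1 := mul_convolution_le rq.
  move/andP: rq => [r0 rq].
  rewrite -sqrt_inv // -sqrt_inv ?subn_gt0 //.
  move: le1; set u := _ / Num.sqrt r%:R; set v := _ / Num.sqrt _ => le1.
  have {}le1 : mul_convolution r ^+ 2 <= (8 * D%:R * (u + v + 4 * q%:R * H)) ^+ 2.
    by rewrite lerXn2r ?nnegrE // (le_trans _ le1).
  apply: le_trans le1 _.
  set w := 4 * q%:R * H.
  have -> : 16 * (q%:R ^+ 2 * H ^+ 2) = w ^+ 2 by rewrite /w !exprMn; ring.
  rewrite exprMn [(8 * _) ^+ 2]exprMn.
  have -> : 192 * D%:R ^+ 2 = 8 ^+ 2 * D%:R ^+ 2 * 3 :> R by ring.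
  rewrite -[leRHS]mulrA ler_wpM2l ?mulr_ge0 ?exprn_ge0 //.
  (* The three squares add up to 3 (u^2 + v^2 + w^2) - (u + v + w)^2. *)
  have := sqr_ge0 (u - v); have := sqr_ge0 (u - w); have := sqr_ge0 (v - w); nra.
apply: le_trans (ler_sum _ pointwise) _.
rewrite -mulr_sumr.
have sum1 : \sum_(r < q | coprime r q) A / r%:R <= A * H.
  rewrite -mulr_sumr ler_wpM2l //; apply: le_trans (sum_inv_le_harmonic R q).
  rewrite big_mkcond [leRHS]big_mkcond; apply: ler_sum => r _.
  case: ifP => [/pos|_]; last by case: ifP => // _; rewrite invr_ge0.
  by rewrite lt0n => /andP[->].
have sum2 : \sum_(r < q | coprime r q) A / (q - r)%:R <= A * H.
  (* The reversal r -> q - 1 - r turns the terms 1 / (r + 1) of [H] into 1 / (q - r). *)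
  rewrite -mulr_sumr ler_wpM2l // /H [leRHS](reindex_inj rev_ord_inj) big_mkcond.
  apply: ler_sum => r _ /=; rewrite -subSn // subSS.
  by case: ifP => // _; rewrite invr_ge0.
have sum3 : \sum_(r < q | coprime r q) 16 * (q%:R ^+ 2 * H ^+ 2) <=
    16 * (q%:R ^+ 3 * H ^+ 2) :> R.
  apply: (@le_trans _ _ (\sum_(r < q) 16 * (q%:R ^+ 2 * H ^+ 2))).
    rewrite big_mkcond; apply: ler_sum => r _; case: ifP => // _.
    by rewrite !mulr_ge0 ?exprn_ge0.
  by rewrite sumr_const card_ord -[leLHS]mulr_natl; lra.
rewrite !big_split /=.
set B : R := q%:R ^+ 3 in sum3 *.
have B0 : 0 <= B by rewrite exprn_ge0.
apply: (@le_trans _ _ (192 * D%:R ^+ 2 * (2 * (A * H) + 16 * (B * H ^+ 2)))).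
  by rewrite ler_wpM2l ?mulr_ge0 ?exprn_ge0 //; lra.
have AH : A * H <= A * H ^+ 2.
  by rewrite ler_wpM2l // expr2 -{1}[H]mulr1 ler_wpM2l //.
have BH : 0 <= B * H ^+ 2 by rewrite mulr_ge0 ?exprn_ge0 //.
have AH0 : 0 <= A * H ^+ 2 by rewrite mulr_ge0 ?exprn_ge0 //.
apply: (@le_trans _ _ (192 * D%:R ^+ 2 * (16 * (A * H ^+ 2 + B * H ^+ 2)))).
  by rewrite ler_wpM2l ?mulr_ge0 ?exprn_ge0 //; lra.
rewrite -mulrDl !exprMn.
have : 0 <= D%:R ^+ 2 * ((A + B) * H ^+ 2) by rewrite mulr_ge0 ?exprn_ge0 // mulrDl addr_ge0.
set z := D%:R ^+ 2 * _ => z0.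
(* 3072 = 192 * 16 is rounded up to 9216 = 96^2, so that the constant is a square. *)
have -> : 192 * D%:R ^+ 2 * (16 * ((A + B) * H ^+ 2)) = 3072 * z by rewrite /z; ring.
have -> : 96 ^+ 2 * D%:R ^+ 2 * H ^+ 2 * (A + B) = 9216 * z by rewrite /z; ring.
by rewrite ler_wpM2r // ler_nat.
Qed.

End Convolution.

(** * The fourth moment *)

(** Lagrange's identity: the double sum of (x_i y_j - x_j y_i)^2 is twice the difference of the two
    sides. *)
Lemma cauchy_schwarz_sum (R : realFieldType) (T : Type) (s : seq T) (x y : T -> R) :
  (\sum_(i <- s) x i * y i) ^+ 2 <=
    (\sum_(i <- s) x i ^+ 2) * (\sum_(i <- s) y i ^+ 2).
Proof.
have : 0 <= \sum_(i <- s) \sum_(j <- s) (x i * y j - x j * y i) ^+ 2.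
  by apply: sumr_ge0 => i _; apply: sumr_ge0 => j _; rewrite sqr_ge0.
have -> : \sum_(i <- s) \sum_(j <- s) (x i * y j - x j * y i) ^+ 2 =
    \sum_(i <- s) \sum_(j <- s) x i ^+ 2 * y j ^+ 2
    + \sum_(i <- s) \sum_(j <- s) y i ^+ 2 * x j ^+ 2
    - 2 * \sum_(i <- s) \sum_(j <- s) (x i * y i) * (x j * y j).
  rewrite mulr_sumr -big_split -sumrB; apply: eq_bigr => i _ /=.
  by rewrite mulr_sumr -big_split -sumrB; apply: eq_bigr => j _ /=; ring.
have prod (f g : T -> R) : \sum_(i <- s) \sum_(j <- s) f i * g j =
    (\sum_(i <- s) f i) * (\sum_(i <- s) g i).
  by rewrite mulr_suml; apply: eq_bigr => i _; rewrite mulr_sumr.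
rewrite (prod (fun i => x i ^+ 2) (fun i => y i ^+ 2)).
rewrite (prod (fun i => y i ^+ 2) (fun i => x i ^+ 2)).
rewrite (prod (fun i => x i * y i) (fun i => x i * y i)); nra.
Qed.

(** Cauchy-Schwarz twice: first with w c = sqrt(w) (sqrt(w) c), then on the resulting sum of w
    c^2. *)
Lemma holder_244 (R : rcfType) (T : Type) (s : seq T) (w c : T -> R) :
  (forall i, 0 <= w i) ->
  (\sum_(i <- s) w i * c i) ^+ 4 <=
    (\sum_(i <- s) w i) ^+ 2 * (\sum_(i <- s) w i ^+ 2) * (\sum_(i <- s) c i ^+ 4).
Proof.
move=> w0.
have w_ge0 : 0 <= \sum_(i <- s) w i by apply: sumr_ge0.
have step1 : (\sum_(i <- s) w i * c i) ^+ 2 <=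
    (\sum_(i <- s) w i) * (\sum_(i <- s) w i * c i ^+ 2).
  have := @cauchy_schwarz_sum R T s (fun i => Num.sqrt (w i))
    (fun i => Num.sqrt (w i) * c i).
  rewrite (_ : \sum_(i <- s) _ * (_ * _) = \sum_(i <- s) w i * c i); last first.
    by apply: eq_bigr => i _; rewrite mulrA -expr2 sqr_sqrtr.
  rewrite (_ : \sum_(i <- s) Num.sqrt _ ^+ 2 = \sum_(i <- s) w i); last first.
    by apply: eq_bigr => i _; rewrite sqr_sqrtr.
  rewrite (_ : \sum_(i <- s) (_ * _) ^+ 2 = \sum_(i <- s) w i * c i ^+ 2) //.
  by apply: eq_bigr => i _; rewrite exprMn sqr_sqrtr.
have step2 := cauchy_schwarz_sum s w (fun i => c i ^+ 2).
rewrite [X in _ <= _ * X](eq_bigr (fun i => c i ^+ 4)) in step2; last first.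
  by move=> i _; rewrite -exprM.
rewrite (exprM _ 2 2).
apply: le_trans (_ : ((\sum_(i <- s) w i) * (\sum_(i <- s) w i * c i ^+ 2)) ^+ 2 <= _).
  rewrite lerXn2r ?nnegrE ?sqr_ge0 // mulr_ge0 //.
  by apply: sumr_ge0 => i _; rewrite mulr_ge0 ?sqr_ge0.
by rewrite exprMn -mulrA ler_wpM2l ?sqr_ge0.
Qed.

Section FourthMoment.
Variables (R : realType) (q : nat).
Hypothesis q_gt0 : (0 < q)%N.

(** Group the pairs of units by r = x y mod q, again a unit, where chi(x) chi(y) = chi(r). *)
Lemma sqr_dirichlet_sum (chi : int -> R[i]) (f : nat -> R[i]) :
  dirichlet_char q chi ->
  (\sum_(x < q | coprime x q) chi x * f x) ^+ 2 =
  \sum_(r < q | coprime r q) chi r *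
    \sum_(x < q | coprime x q)
      \sum_(y < q | coprime y q && (x * y %% q == r)%N) f x * f y.
Proof.
move=> chiq; have [_ mul _] := chiq.
rewrite expr2 mulr_suml.
under [RHS]eq_bigr do rewrite mulr_sumr.
rewrite [RHS]exchange_big; apply: eq_bigr => x cx /=.
pose h (y : 'I_q) := Ordinal (ltn_pmod (x * y) q_gt0).
rewrite mulr_sumr (partition_big h (fun r : 'I_q => coprime r q)) /=; last first.
  by move=> y cy; rewrite coprime_modl coprimeMl cx.
apply: eq_bigr => r _; rewrite mulr_sumr; apply: eq_big => [y|y]; first by rewrite -val_eqE.
case/andP=> _ /eqP <- /=.
by rewrite -modz_nat -dirichlet_char_modz // PoszM mul mulrACA.
Qed.

(** A fourth power is the square of a squared sum, itself a character sum with coefficients [F]; the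
    large sieve applies to it. *)
Lemma fourth_moment_le_convolution (s : seq (int -> R[i])) (f : nat -> R[i]) :
  uniq s -> {in s, forall chi, dirichlet_char q chi} ->
  \sum_(chi <- s) normc (\sum_(x < q | coprime x q) chi x * f x) ^+ 4 <=
    q%:R * \sum_(r < q | coprime r q) mul_convolution q (fun x => normc (f x)) r ^+ 2.
Proof.
move=> us sq.
pose F (r : nat) := \sum_(x < q | coprime x q)
  \sum_(y < q | coprime y q && (x * y %% q == r)%N) f x * f y.
have -> : \sum_(chi <- s) normc (\sum_(x < q | coprime x q) chi x * f x) ^+ 4 =
    \sum_(chi <- s) normc (\sum_(x < q | coprime x q) chi x * F x) ^+ 2.
  rewrite big_seq [RHS]big_seq; apply: eq_bigr => chi /sq chiq.
  by rewrite (exprM _ 2 2) -normcX sqr_dirichlet_sum.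
apply: le_trans (dirichlet_char_large_sieve q_gt0 F us sq) _.
rewrite ler_wpM2l //; apply: ler_sum => r _.
have FG : normc (F r) <= mul_convolution q (fun x => normc (f x)) r.
  apply: le_trans (normc_sum _ _ _) _; apply: ler_sum => x _.
  apply: le_trans (normc_sum _ _ _) _; apply: ler_sum => y _.
  by rewrite normcM.
by rewrite lerXn2r ?nnegrE ?(le_trans _ FG) ?normc_ge0.
Qed.

End FourthMoment.

(** * Bounds by powers q^delta and the final assembly *)

Lemma divisor_bound_powR (R : realType) (delta : R) : 0 < delta ->
  exists2 C : R, 1 <= C & forall q : nat, (0 < q)%N ->
    exists2 D : nat, D%:R <= C * q%:R `^ delta &
      forall m, (0 < m <= q ^ 2)%N -> (size (divisors m) <= D)%N.
Proof.
move=> d0.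
(* With k > 2 / delta, the bound D^k <= C0 q^2 on the maximal number of divisors up to q^2 implies D
   <= C0 q^delta. *)
pose k := (Num.truncn (2 / delta)).+1.
have kd : 2 <= delta * k%:R.
  by rewrite mulrC -ler_pdivrMr // ltW // truncnS_gt.
have [C0 hC0] := divisor_bound k.
(* The case m = 1 forces C0 >= 1, which later gives C0 <= C0^k. *)
have C0_gt0 : (0 < C0)%N by have := hC0 1%N isT; rewrite muln1 /=; case: (C0) => //; rewrite leqn0 expn_eq0.
exists C0%:R; first by rewrite ler1n.
move=> q q0; exists (\max_(m < (q ^ 2).+1 | (0 < m)%N) size (divisors m))%N; last first.
  move=> m /andP[m0 mq]; have lt : (m < (q ^ 2).+1)%N by [].
  exact: (@leq_bigmax_cond _ _ (fun m : 'I__ => size (divisors m)) (Ordinal lt)).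
set D := (\max_(m < _ | _) _)%N.
have Dk : (D ^ k <= C0 * q ^ 2)%N.
  apply: (big_ind (fun x => (x ^ k <= C0 * q ^ 2)%N)); first by rewrite exp0n.
    by move=> x y hx hy; rewrite /maxn; case: ifP.
  move=> m m0; apply: leq_trans (hC0 _ m0) _.
  by rewrite leq_mul2l -ltnS ltn_ord orbT.
rewrite -(@ler_pXn2r _ k) ?nnegrE ?mulr_ge0 ?powR_ge0 //.
have q1 : 1 <= q%:R :> R by rewrite ler1n.
apply: (@le_trans _ _ (C0%:R * q%:R ^+ 2)); first by rewrite -!natrX -natrM ler_nat.
rewrite exprMn ler_pM ?exprn_ge0 //.
  by rewrite -natrX ler_nat -{1}[C0]expn1 leq_pexp2l.
rewrite -[in leRHS]powR_mulrn ?powR_ge0 // -powRrM -powR_mulrn //.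
by rewrite ler_powR.
Qed.

Lemma harmonic_le_powR (R : realType) (delta : R) (q : nat) : 0 < delta -> (0 < q)%N ->
  \sum_(k < q) k.+1%:R^-1 <= (1 + delta^-1) * q%:R `^ delta :> R.
Proof.
move=> d0 q0; apply: le_trans (harmonic_le_ln R q0) _.
rewrite mulrDl mul1r lerD // ?ln_le_powR ?ltr0n //.
by rewrite -[leLHS](powRr0 q%:R) ler_powR ?ler1n // ltW.
Qed.

Lemma powR_exprn (R : realType) (x a : R) (n m : nat) : 0 <= x -> a * n%:R = m%:R ->
  (x `^ a) ^+ n = x ^+ m.
Proof. by move=> x0 E; rewrite -powR_mulrn ?powR_ge0 // -powRrM E powR_mulrn. Qed.

Section Assembly.
Variables (R : realType) (q : nat).
Hypothesis q_gt0 : (0 < q)%N.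
Implicit Type w : (int -> R[i]) -> R[i].

Local Notation chars := (finmap.enum_fset (fset_set (@primitive_char R q))).

Lemma mem_primitive_enum : {in chars, forall chi, dirichlet_char q chi}.
Proof.
move=> chi; rewrite in_fset_set; last exact: finite_primitive_char.
by rewrite inE => -[].
Qed.

Lemma wnorm1E w : wnorm q w 1 = \sum_(chi <- chars) normc (w chi).
Proof.
rewrite /wnorm fsbig_finite /=; last exact: finite_primitive_char.
rewrite invr1 powRr1; last by apply: sumr_ge0 => chi _; rewrite powR_ge0.
by apply: eq_bigr => chi _; rewrite powRr1 ?normc_ge0.
Qed.

Lemma wnorm2_sqr w : wnorm q w 2 ^+ 2 = \sum_(chi <- chars) normc (w chi) ^+ 2.
Proof.
rewrite /wnorm fsbig_finite /=; last exact: finite_primitive_char.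
rewrite (@powR_exprn _ _ _ 2 1) ?mulVf ?expr1 //; last first.
  by apply: sumr_ge0 => chi _; rewrite powR_ge0.
by apply: eq_bigr => chi _; rewrite -[2]/(2%:R) powR_mulrn ?normc_ge0.
Qed.

(** Open the Gauss sums, exchange the sums over n and x, and apply the triangle inequality over chi
    only, keeping the cancellation in the inner sums. *)
Lemma normc_T_le w L N : normc (T_ q w L N) <=
  \sum_(chi <- chars) normc (w chi) *
    normc (\sum_(x < q | coprime x q) chi x * interval_sum R q L N x).
Proof.
rewrite /T_ fsbig_finite /=; last exact: finite_primitive_char.
apply: le_trans (normc_sum _ _ _) _; apply: ler_sum => chi _.
rewrite -mulr_sumr normcM /gauss_sum exchange_big /=.
under eq_bigr do rewrite -mulr_sumr.
exact: lexx.
Qed.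

(** The convolution bound with b = |gamma|; the factor q of the large sieve raises each power of q
    by one. *)
Lemma fourth_moment_le (L N D : nat) : (1 < q)%N ->
  (forall m, (0 < m <= q ^ 2)%N -> (size (divisors m) <= D)%N) ->
  \sum_(chi <- chars)
     normc (\sum_(x < q | coprime x q) chi x * interval_sum R q L N x) ^+ 4 <=
  (96 * D%:R * \sum_(k < q) k.+1%:R^-1) ^+ 2 * (N%:R ^+ 2 * q%:R ^+ 3 + q%:R ^+ 4).
Proof.
move=> q1 hD.
apply: le_trans (fourth_moment_le_convolution q_gt0 _ (finmap.fset_uniq _) mem_primitive_enum) _.
have b0 x : 0 <= normc (interval_sum R q L N x) := normc_ge0 _.
have bN x : normc (interval_sum R q L N x) <= N%:R := interval_sum_le_N _ _ _ _ _.
have binv x : (0 < x < q)%N -> normc (interval_sum R q L N x) <=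
    2 * q%:R / (abs_mod q x)%:R by move=> hx; exact: interval_sum_le_inv.
have := sum_sqr_mul_convolution_le b0 bN binv hD q1.
rewrite -(ler_pM2l (_ : 0 < q%:R :> R)) ?ltr0n // => /le_trans -> //.
by rewrite le_eqVlt; apply/orP; left; apply/eqP; ring.
Qed.

Lemma normc_T_pow4_le w (L N D : nat) : (1 < q)%N ->
  (forall m, (0 < m <= q ^ 2)%N -> (size (divisors m) <= D)%N) ->
  normc (T_ q w L N) ^+ 4 <= wnorm q w 1 ^+ 2 * wnorm q w 2 ^+ 2 *
    ((96 * D%:R * \sum_(k < q) k.+1%:R^-1) ^+ 2 * (N%:R ^+ 2 * q%:R ^+ 3 + q%:R ^+ 4)).
Proof.
move=> q1 hD.
have T_le := normc_T_le w L N.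
have {T_le} : normc (T_ q w L N) ^+ 4 <= (\sum_(chi <- chars) normc (w chi) *
    normc (\sum_(x < q | coprime x q) chi x * interval_sum R q L N x)) ^+ 4.
  by rewrite lerXn2r ?nnegrE ?(le_trans _ T_le) ?normc_ge0.
move/le_trans; apply.
apply: le_trans (holder_244 _ _ (fun chi => normc_ge0 (w chi))) _.
rewrite -wnorm1E -wnorm2_sqr ler_wpM2l ?(mulr_ge0, exprn_ge0, powR_ge0) //.
exact: fourth_moment_le.
Qed.
End Assembly.

Theorem theorem2p3 (R : realType) (delta : R) (hdelta : 0 < delta) :
  exists2 C : R, 0 < C &
    forall (q L N : nat) (w : (int -> R[i]) -> R[i]),
      (0 < q)%N -> (L + N <= q - 1)%N ->
      normc (T_ q w L N) <=
        C * (wnorm q w 1 * wnorm q w 2) `^ (1 / 2)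
          * (q%:R + N%:R `^ (1 / 2) * q%:R `^ (3 / 4)) * q%:R `^ delta.
Proof.
have [C1 C1_ge1 hC1] := divisor_bound_powR hdelta.
pose C2 := 1 + delta^-1.
have C2_ge1 : 1 <= C2 by rewrite lerDl invr_ge0 ltW.
have C1_ge0 := le_trans ler01 C1_ge1; have C2_ge0 := le_trans ler01 C2_ge1.
(* Chosen so that 96 D H <= C q^(2 delta), with [C1] from the divisor bound and [C2] from the
   harmonic sum. *)
pose C := 96 * C1 * C2.
have C_ge1 : 1 <= C by rewrite -[1]mulr1 ler_pM //; nra.
have C_gt0 : 0 < C := lt_le_trans ltr01 C_ge1.
exists C => // q L N w q0 LN.
(* For q = 1 the interval is empty and the sum vanishes. *)
have [q1|q_gt1] := leqP q 1.
  have N0 : N = 0%N by lia.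
  apply: (@le_trans _ _ 0); last first.
    have Y0 : 0 <= q%:R + N%:R `^ (1 / 2) * q%:R `^ (3 / 4) :> R.
      by rewrite addr_ge0 ?mulr_ge0 ?powR_ge0.
    apply: mulr_ge0; last exact: powR_ge0.
    by apply: mulr_ge0 => //; apply: mulr_ge0; [exact: ltW | exact: powR_ge0].
  apply: le_trans (normc_T_le q0 w L N) _.
  rewrite big1 // => chi _; rewrite [X in _ * normc X](_ : _ = 0) ?normc0 ?mulr0 //.
  by rewrite big1 // => x _; rewrite /interval_sum N0 addn0 big_geq ?mulr0.
have [D D_le hD] := hC1 q q0.
have H_le := harmonic_le_powR hdelta q0.
have := normc_T_pow4_le q0 w L N q_gt1 hD.
set H := \sum_(k < q) _ in H_le *; set Z := q%:R `^ delta in D_le H_le *.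
set Y := q%:R + _; set X := (_ * _) `^ _.
move=> T4.
have H0 : 0 <= H by apply: sumr_ge0 => k _; rewrite invr_ge0.
have Z0 : 0 <= Z := powR_ge0 _ _.
have X0 : 0 <= X := powR_ge0 _ _.
have n0 : 0 <= N%:R `^ (1 / 2) * q%:R `^ (3 / 4) :> R by rewrite mulr_ge0 ?powR_ge0.
have Y0 : 0 <= Y by rewrite addr_ge0.
(* Fourth powers are superadditive on nonnegative reals; the two summands of [Y] have exactly the
   fourth powers on the left. *)
have Y4 : N%:R ^+ 2 * q%:R ^+ 3 + q%:R ^+ 4 <= Y ^+ 4.
  have -> : N%:R ^+ 2 * q%:R ^+ 3 = (N%:R `^ (1 / 2) * q%:R `^ (3 / 4)) ^+ 4 :> R.
    by rewrite exprMn (@powR_exprn _ _ _ 4 2) ?(@powR_exprn _ _ _ 4 3) //; field.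
  rewrite /Y; move: n0; set a := _ * _; have : 0 <= q%:R :> R by [].
  move: (q%:R : R) a => u a u0 a0.
  have -> : (u + a) ^+ 4 = a ^+ 4 + u ^+ 4 + (4 * (u ^+ 3 * a) + 6 * (u ^+ 2 * a ^+ 2) + 4 * (u * a ^+ 3)) by ring.
  by rewrite lerDl !addr_ge0 ?mulr_ge0 ?exprn_ge0.
have X4 : X ^+ 4 = wnorm q w 1 ^+ 2 * wnorm q w 2 ^+ 2.
  rewrite (@powR_exprn _ _ _ 4 2) ?exprMn ?mulr_ge0 ?powR_ge0 //.
  by field.
have DH : 96 * D%:R * H <= C * Z ^+ 2.
  by have := ler_pM (ler0n R D) H0 D_le H_le; rewrite /C -/C2; nra.
rewrite -(@ler_pXn2r _ 4) ?nnegrE ?normc_ge0 ?mulr_ge0 ?(ltW C_gt0) //.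
apply: le_trans T4 _; rewrite -X4.
have -> : (C * X * Y * Z) ^+ 4 = X ^+ 4 * (C ^+ 4 * Z ^+ 4 * Y ^+ 4) by ring.
rewrite ler_wpM2l ?exprn_ge0 // ler_pM ?sqr_ge0 ?addr_ge0 ?mulr_ge0 ?exprn_ge0 //.
(* Only (D H)^(1/2) survives the fourth root, so [D] and [H] may each cost a full q^delta; C >= 1
   gives C^2 <= C^4. *)
apply: (@le_trans _ _ ((C * Z ^+ 2) ^+ 2)).
  by rewrite lerXn2r ?nnegrE ?(le_trans _ DH) // !mulr_ge0.
rewrite exprMn -exprM ler_wpM2r ?exprn_ge0 //.
by rewrite ler_weXn2l.
Qed.
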